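(* Let $P(\lambda)=\lambda^3+A\lambda^2+B\lambda+D\in\mathbb{R}[\lambda]$. Then $P$ is stable if and only if $$|D|<1\quad\text{and}\quad \max\{-P(1),\,P(-1)\}<0<\hat\alpha,$$ where $\hat\alpha=\hat\alpha(P):=-D^2+AD-B+1$.
   Context: A polynomial over $\mathbb{R}$ is called stable if all of its (complex) roots lie in $\{z\in\mathbb{C}:|z|<1\}$. *)

(* Defs.v *)
From HB Require Import structures.
From mathcomp Require Import all_boot all_order all_algebra.
From mathcomp Require Import complex reals.

Set Implicit Arguments.
Unset Strict Implicit.
Unset Printing Implicit Defensive.

Import Order.TTheory GRing.Theory Num.Theory.

Local Open Scope ring_scope.
Local Open Scope complex_scope.

(* [`|z|] is itself an element of [R[i]]; in the order of [R[i]], [`|z| < 1]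
   compares the real numbers [|z|] and [1]. *)
Definition stable (R : realType) (p : {poly R}) : Prop :=
  forall z : R[i], root (map_poly (real_complex R) p) z -> `|z| < 1.

Definition alpha_hat (R : realType) (A B D : R) : R :=
  - D ^+ 2 + A * D - B + 1.

(* Main.v *)
(* A real cubic has a real root [r], so [P = (X - r) Q] with [Q = X^2 + p X + q].
   Then [P(1) = (1 - r) Q(1)], [- P(-1) = (1 + r) Q(-1)], [D = - r q], and
   [alpha_hat = (1 - q) (1 + r p + r^2 q)], whose last factor is
   [(1 - r z1) (1 - r z2)] for the roots [z1], [z2] of [Q].  As [Q] is stable iff
   [q < 1] and [Q(1)], [Q(-1)] are positive, it remains to compare real
   inequalities in [r], [p] and [q]. *)
Require Import Defs.
From HB Require Import structures.
From mathcomp Require Import all_boot all_order all_algebra.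
From mathcomp Require Import complex reals.
From mathcomp Require Import ring lra.

Set Implicit Arguments.
Unset Strict Implicit.
Unset Printing Implicit Defensive.

Import Order.TTheory GRing.Theory Num.Theory.

Local Open Scope ring_scope.

Lemma complex_norm_lt1 (R : rcfType) (x y : R) :
  (`|(x +i* y)%C| < 1) = (x ^+ 2 + y ^+ 2 < 1).
Proof. by rewrite normc_def ltcE /= eqxx /= -[ltRHS]sqrtr1 ltr_sqrt. Qed.

Lemma monic_cubic_root (R : rcfType) (A B D : R) :
  exists r, r ^+ 3 + A * r ^+ 2 + B * r + D = 0.
Proof.
pose P : {poly R} := 'X^3 + A *: 'X^2 + B *: 'X + D%:P.
have PE x : P.[x] = x ^+ 3 + A * x ^+ 2 + B * x + D by rewrite !hornerE.
(* Since [M >= 1], the lower terms at [M] and [-M] are at most [(|A| + |B| + |D|) M^2 = M^3 - M^2]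
   in absolute value, so the cubic term decides the sign of [P] at both ends. *)
pose M := 1 + `|A| + `|B| + `|D|.
have [A0 B0 D0] : [/\ 0 <= `|A|, 0 <= `|B| & 0 <= `|D|] by split.
have M1 : 1 <= M by rewrite /M; lra.
have bA : `|A * M ^+ 2| <= `|A| * M ^+ 2 by rewrite normrM (ger0_norm (sqr_ge0 _)).
have bB : `|B * M| <= `|B| * M ^+ 2.
  rewrite normrM ler_wpM2l// ger0_norm; nra.
have bD : `|D| <= `|D| * M ^+ 2 by rewrite ler_peMr// expr_ge1//; lra.
have M3 : M ^+ 3 = (1 + `|A| + `|B| + `|D|) * M ^+ 2 by rewrite exprS.
clearbody M.
have M2 : 0 <= M ^+ 2 by exact: sqr_ge0.
move: bA bB bD; rewrite !ler_norml => /andP[a1 a2] /andP[b1 b2] dd.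
have /andP[d1 d2] : - `|D| <= D <= `|D| by rewrite -ler_norml.
have [||x _ /rootP] := @poly_ivt R P (- M) M; first lra.
  have M3N : (- M) ^+ 3 = - M ^+ 3 by rewrite exprNn; ring.
  rewrite !PE sqrrN M3N M3.
  by apply/andP; split; nra.
by rewrite PE; exists x.
Qed.

(* The two equations are the real and imaginary parts of [Q(x + i y) = 0]. *)
Lemma stable_factor (R : realType) (A B D r p q : R) :
  A = p - r -> B = q - r * p -> D = - (r * q) ->
  stable ('X^3 + A *: 'X^2 + B *: 'X + D%:P) <->
  `|r| < 1 /\ (forall x y : R, x ^+ 2 - y ^+ 2 + p * x + q = 0 ->
     (2 * x + p) * y = 0 -> x ^+ 2 + y ^+ 2 < 1).
Proof.
move=> -> -> ->.
have rootE (x y : R) : root (map_poly (real_complex R)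
   ('X^3 + (p - r) *: 'X^2 + (q - r * p) *: 'X + (- (r * q))%:P)) (x +i* y)%C
   = ((x == r) && (y == 0)) ||
     ((x ^+ 2 - y ^+ 2 + p * x + q == 0) && ((2 * x + p) * y == 0)).
  have -> : 'X^3 + (p - r) *: 'X^2 + (q - r * p) *: 'X + (- (r * q))%:P
    = ('X - r%:P) * ('X^2 + p *: 'X + q%:P) :> {poly R}.
    rewrite -!mul_polyC !(rmorphB, rmorphN, rmorphM) /=; ring.
  rewrite rmorphM /= rootM; congr (_ || _).
    by rewrite map_polyXsubC root_XsubC eq_complex.
  rewrite /root !rmorphD /= map_polyZ /= map_polyXn map_polyX map_polyC !hornerE.
  rewrite eq_complex /=; congr (_ && _); congr (_ == _); ring.
split=> [st | [r1 qs] [x y]].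
  split=> [|x y e1 e2].
    have := st (r +i* 0)%C; rewrite rootE complex_norm_lt1 !eqxx /= => /(_ isT).
    by rewrite expr0n addr0 ltr_norml => h; apply/andP; split; nra.
  by rewrite -complex_norm_lt1 st// rootE e1 e2 !eqxx orbT.
rewrite rootE complex_norm_lt1 => /orP[/andP[/eqP-> /eqP->]|/andP[/eqP e1 /eqP e2]].
  by move: r1; rewrite ltr_norml => /andP[]; nra.
exact: qs.
Qed.

Lemma quadratic_stable (R : rcfType) (p q : R) :
  (forall x y : R, x ^+ 2 - y ^+ 2 + p * x + q = 0 ->
     (2 * x + p) * y = 0 -> x ^+ 2 + y ^+ 2 < 1) <->
  [/\ q < 1, 0 < 1 + p + q & 0 < 1 - p + q].
Proof.
split=> [st | [q1 h1 h2] x y e1 /eqP].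
  have [d0|d0] := lerP 0 (p ^+ 2 - 4 * q).
    pose s := Num.sqrt (p ^+ 2 - 4 * q).
    have s2 : s ^+ 2 = p ^+ 2 - 4 * q by rewrite sqr_sqrtr.
    have a1 : ((- p + s) / 2) ^+ 2 + 0 ^+ 2 < 1 by apply: st; [nra|lra].
    have a2 : ((- p - s) / 2) ^+ 2 + 0 ^+ 2 < 1 by apply: st; [nra|lra].
    (* By Vieta, [1 + p + q = (1 - u) (1 - v)] and [1 - p + q = (1 + u) (1 + v)]. *)
    pose u := (- p + s) / 2; pose v := (- p - s) / 2.
    have pE : p = - (u + v) by rewrite /u /v; field.
    have qE : q = u * v by rewrite /u /v; nra.
    have {}a1 : u ^+ 2 < 1 by move: a1; rewrite expr0n addr0.
    have {}a2 : v ^+ 2 < 1 by move: a2; rewrite expr0n addr0.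
    have [u1 u2] : -1 < u /\ u < 1 by split; nra.
    have [v1 v2] : -1 < v /\ v < 1 by split; nra.
    by rewrite pE qE; split; nra.
  (* A conjugate pair has squared modulus [q], and [p^2 < 4 q <= (1 + q)^2] bounds [|p|]. *)
  pose s := Num.sqrt (4 * q - p ^+ 2).
  have s2 : s ^+ 2 = 4 * q - p ^+ 2 by rewrite sqr_sqrtr//; lra.
  have : (- p / 2) ^+ 2 + (s / 2) ^+ 2 < 1 by apply: st; [nra|lra].
  by split; nra.
(* If [p = - 2 x], then [e1] reads [x^2 + y^2 = q]. *)
rewrite mulf_eq0 => /orP[/eqP e2|/eqP y0]; first nra.
rewrite y0 in e1 *.
have e : x ^+ 2 + p * x + q = 0 by lra.
have [x1 x2] : -1 < x /\ x < 1.
  (* The other root is [v = - p - x]. If [x >= 1], then [(1 - x) (1 - v) > 0] forces [x > 1] and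
     [v > 1], hence [q = x v > 1]; the case [x <= -1] is symmetric. *)
  split; rewrite ltNge; apply/negP => h; nra.
nra.
Qed.

(** Once [|r| < 1], the conditions match factor by factor; the main point is that the products force
    this bound. *)
Lemma factored_conditions (R : realDomainType) (r p q : R) :
  (`|r| < 1 /\ [/\ q < 1, 0 < 1 + p + q & 0 < 1 - p + q]) <->
  [/\ `|r * q| < 1, 0 < (1 - r) * (1 + p + q), 0 < (1 + r) * (1 - p + q)
    & 0 < (1 - q) * (1 + r * p + r ^+ 2 * q)].
Proof.
(* As |p| < 1 + q, this is at least 1 - |r| (1 + q) + r^2 q = (1 - |r|) (1 - |r| q). *)
have key : `|r| < 1 -> `|r * q| < 1 -> 0 < 1 + p + q -> 0 < 1 - p + q ->
    0 < 1 + r * p + r ^+ 2 * q.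
  rewrite !ltr_norml => /andP[r1 r2] /andP[q1 q2] h1 h2.
  have [r0|r0] := lerP 0 r.
    have : 0 < (1 - r) * (1 - r * q) by apply: mulr_gt0; lra.
    nra.
  have : 0 < (1 + r) * (1 + r * q) by apply: mulr_gt0; lra.
  nra.
split=> [[r1 [q1 h1 h2]]|[rq h1 h2 al]].
  have rq : `|r * q| < 1.
    rewrite normrM -[ltRHS]mulr1 ltr_pM// ltr_norml; lra.
  have k := key r1 rq h1 h2.
  move: r1; rewrite ltr_norml => /andP[r1 r2].
  by split=> //; apply: mulr_gt0 => //; lra.
have r1 : `|r| < 1.
  move: rq; rewrite !ltr_norml => /andP[q1 q2].
  apply/andP; split; rewrite ltNge; apply/negP => h.
    (* If [r <= -1], the signs give [r < -1], [q < 1] and [p > 1 + q]. Then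
       [1 + r p + r^2 q < (1 + r) (1 + r q) < 0], against [al]. The case [r >= 1] mirrors this under
       [(r, p) -> (-r, -p)]. *)
    have r0 : 1 + r < 0.
      suff : 1 + r != 0 by rewrite neq_lt => /orP[//|]; lra.
      by apply: contraTneq h2 => ->; rewrite mul0r ltxx.
    have q0 : 0 < 1 - q by nra.
    have g2 : 1 - p + q < 0 by nra.
    have k : 0 < 1 + r * p + r ^+ 2 * q by rewrite -(pmulr_rgt0 _ q0).
    have : (1 + r) * (1 + r * q) < 0 by rewrite nmulr_rlt0; lra.
    nra.
  have r0 : 1 - r < 0.
    suff : 1 - r != 0 by rewrite neq_lt => /orP[//|]; lra.
    by apply: contraTneq h1 => ->; rewrite mul0r ltxx.
  have q0 : 0 < 1 - q by nra.
  have g1 : 1 + p + q < 0 by nra.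
  have k : 0 < 1 + r * p + r ^+ 2 * q by rewrite -(pmulr_rgt0 _ q0).
  have : (1 - r) * (1 - r * q) < 0 by rewrite nmulr_rlt0; lra.
  nra.
have [g1 g2] : 0 < 1 + p + q /\ 0 < 1 - p + q.
  move: r1; rewrite ltr_norml => /andP[r1 r2].
  move: h1 h2; rewrite !pmulr_rgt0; lra.
split=> //; split=> //.
by move: al; rewrite (pmulr_lgt0 _ (key r1 rq g1 g2)); lra.
Qed.

Theorem proposition3 (R : realType) (A B D : R) :
  let P : {poly R} := 'X^3 + A *: 'X^2 + B *: 'X + D%:P in
  stable P <->
    (`|D| < 1 /\ Num.max (- P.[1]) P.[-1] < 0 < alpha_hat A B D).
Proof.
move=> P.
have [r hr] := monic_cubic_root A B D.
(* Synthetic division of [P] by [X - r]; the vanishing remainder is [DE]. *)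
pose p := A + r; pose q := B + r * p.
have AE : A = p - r by rewrite /p; ring.
have BE : B = q - r * p by rewrite /q; ring.
have DE : D = - (r * q) by rewrite /q /p; lra.
clearbody p q.
have PE x : P.[x] = x ^+ 3 + A * x ^+ 2 + B * x + D by rewrite !hornerE.
have P1 : P.[1] = (1 - r) * (1 + p + q) by rewrite PE AE BE DE; ring.
have PN1 : P.[-1] = - ((1 + r) * (1 - p + q)) by rewrite PE AE BE DE; ring.
have aE : alpha_hat A B D = (1 - q) * (1 + r * p + r ^+ 2 * q).
  by rewrite /alpha_hat AE BE DE; ring.
rewrite /P (stable_factor AE BE DE) quadratic_stable factored_conditions.
rewrite -/P gt_max P1 PN1 aE DE normrN !oppr_lt0.
by split=> [[-> -> -> ->]|[-> /andP[/andP[-> ->] ->]]].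
Qed.
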